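(* Let $\mathcal{C}=\{C_1,\dots,C_g\}$ be a circuit system for a matroid $M$, and let $w_i$ be the indicator vector of $C_i$ in the $\mathbb{F}_2$-vector space with basis $E(M)$. Then $w_1,\dots,w_g$ are linearly independent in the circuit space of $M$. In particular, if $M$ is binary, then $\{w_1,\dots,w_g\}$ is a basis of the circuit space of $M$.
   Context: Matroids are on finite ground sets; $g(M)=|E(M)|-r(M)$ is the corank. Unique union: for a family $\mathcal{A}=\{A_1,\dots,A_g\}$ of subsets of a set and $\sigma\subseteq[g]=\{1,\dots,g\}$, $\mathcal{A}_\sigma$ is the set of elements $e\in\bigcup_{i\in\sigma}A_i$ for which there is exactly one $i\in\sigma$ with $e\in A_i$. A *circuit system* for $M$ is a collection $\mathcal{C}=\{C_1,\dots,C_g\}$ of circuits of $M$ with $g=g(M)$ such that for every nonempty $\sigma\subseteq[g]$ the unique union $\mathcal{C}_\sigma$ is dependent in $M$. The *circuit space* of $M$ is the subspace of the $\mathbb{F}_2$-vector space with basis $E(M)$ spanned by the indicator vectors of the circuits of $M$. *)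

(* Defs.v *)
From HB Require Import structures.
From mathcomp Require Import all_boot all_order all_algebra.
Set Implicit Arguments.
Unset Strict Implicit.
Unset Printing Implicit Defensive.
Import GRing.Theory.
Local Open Scope ring_scope.

(* The ground set E(M) is the whole finite type E. *)
Record matroid (E : finType) := Matroid {
  indep : {set E} -> bool;
  indep0 : indep set0;
  indepS : forall A B : {set E}, A \subset B -> indep B -> indep A;
  indep_aug : forall A B : {set E}, indep A -> indep B -> (#|A| < #|B|)%N ->
    exists2 e, e \in B :\: A & indep (e |: A) }.

Definition dependent (E : finType) (M : matroid E) (A : {set E}) : bool :=
  ~~ indep M A.

Definition circuit (E : finType) (M : matroid E) (C : {set E}) : bool :=
  minset (dependent M) C.

Definition rank (E : finType) (M : matroid E) : nat :=
  (\max_(A : {set E} | indep M A) #|A|)%N.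

Definition corank (E : finType) (M : matroid E) : nat := (#|E| - rank M)%N.

Definition unique_union (E I : finType) (A : I -> {set E}) (s : {set I}) :
    {set E} :=
  [set e in \bigcup_(i in s) A i | #|[set i in s | e \in A i]| == 1%N].

(* Indexed as a family; the C i are nevertheless pairwise distinct, since
   C i = C j with i != j would make the unique union over {i, j} empty. *)
Definition circuit_system (E : finType) (M : matroid E) (g : nat)
    (C : 'I_g -> {set E}) : Prop :=
  [/\ g = corank M,
      forall i, circuit M (C i) &
      forall s : {set 'I_g}, s != set0 -> dependent M (unique_union C s)].

(* {ffun E -> ('F_2)^o} is the 'F_2-vector space with basis E; the ^o makes 'F_2
   a vector space over itself. *)
Definition indicator (E : finType) (A : {set E}) : {ffun E -> ('F_2)^o} :=
  [ffun e => (e \in A)%:R].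

Definition circuit_space (E : finType) (M : matroid E) :
    {vspace {ffun E -> ('F_2)^o}} :=
  <<[seq indicator C | C : {set E} in circuit M]>>%VS.

(* [free] is about sequences, so parallel elements represented by equal vectors
   are dependent. *)
Definition representable (F : fieldType) (E : finType) (M : matroid E) : Prop :=
  exists (n : nat) (v : E -> 'rV[F]_n),
    forall A : {set E}, indep M A = free [seq v e | e in A].

Definition binary (E : finType) (M : matroid E) : Prop := representable 'F_2 M.

(* Main.v *)
(** Modulo 2, a relation among the w_i is a subset s of [g] whose sum vanishes;
then no element lies in exactly one C_i with i in s, so the unique union over
s is empty, hence independent, and s must be empty.  If M is represented over
'F_2 by vectors v_e, the linear map x |-> \sum_e x_e v_e has rank at least
r(M) and kills every circuit, so the circuit space has dimension at most
g(M), and g(M) independent vectors in it form a basis. *)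

Require Import Defs.
From HB Require Import structures.
From mathcomp Require Import all_boot all_order all_algebra.
Set Implicit Arguments.
Unset Strict Implicit.
Unset Printing Implicit Defensive.
Import GRing.Theory.
Local Open Scope ring_scope.

(** Indexing the coefficients by elements of [T] rather than by positions in the sequence lets the
    support of a relation be treated as a set. *)
Lemma free_imageP (K : fieldType) (V : vectType K) (T : finType) (v : T -> V)
    (A : {pred T}) :
  reflect (forall k : T -> K,
             \sum_(e in A) k e *: v e = 0 -> forall e, e \in A -> k e = 0)
          (free [seq v e | e in A]).
Proof.
have nthE (i : 'I_#|A|) : [seq v e | e in A]`_i = v (enum_val i).
  rewrite (nth_map (enum_val i)) -?cardE //.
  by rewrite -enum_val_nth.
have szX : size [seq v e | e in A] == #|A| by rewrite size_image.
apply: (iffP (@freeP _ _ _ (Tuple szX))) => [frX k k0 e eA | frA k k0 i] /=.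
  rewrite -(enum_rankK_in eA eA).
  apply: (frX (fun i => k (enum_val i))); rewrite -[RHS]k0 [RHS]big_enum_val.
  by apply: eq_bigr => i _; rewrite nthE.
(* [k'] carries coefficients from positions back to elements, extended by 0 outside [A]. *)
pose k' e := if insub e : option {x | x \in A} is Some x
             then k (enum_rank_in (valP x) (val x)) else 0.
have k'E j : k' (enum_val j) = k j.
  rewrite /k' insubT ?enum_valP // => Aj /=.
  by rewrite enum_valK_in.
rewrite -k'E; apply: frA (enum_valP i); rewrite -[RHS]k0 [LHS]big_enum_val.
by apply: eq_bigr => j _; rewrite nthE k'E.
Qed.

Lemma F2_boolE (x : 'F_2) : x = (x != 0)%:R.
Proof. by case: x => [[|[|[]]] //= ?]; apply/val_inj. Qed.

Lemma dim_ffun_regular (F : fieldType) (E : finType) :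
  \dim {: {ffun E -> F^o}} = #|E|.
Proof. by rewrite dimvf /dim /= muln1. Qed.

Lemma free_indicator (E I : finType) (A : I -> {set E}) :
  (forall s : {set I}, s != set0 -> unique_union A s != set0) ->
  free [seq indicator (A i) | i : I].
Proof.
move=> uu; apply/free_imageP => k k0.
pose s := [set i | k i != 0].
have [s0 i _ | /uu/set0Pn[e]] := eqVneq s set0.
  by apply/eqP/negPn; have := in_set0 i; rewrite -s0 inE => ->.
rewrite inE => /andP[_ /eqP card1].
(* At [e] the relation counts modulo 2 the members of its support [s] that contain [e]; [e] was
   chosen so that this count is 1. *)
move/ffunP/(_ e)/eqP: k0; rewrite sum_ffunE ffunE.
suff -> : \sum_(i : I) (k i *: indicator (A i)) e = 1 by rewrite oner_eq0.
rewrite -[RHS](congr1 (fun n => n%:R : 'F_2) card1) -sum1_card natr_sum.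
rewrite [RHS]big_mkcond /=.
apply: eq_bigr => i _; rewrite !ffunE !inE {1}(F2_boolE (k i)).
by case: (k i == 0); case: (e \in A i); rewrite ?scale0r ?scale1r.
Qed.

Section BinaryRepresentation.
Variables (E : finType) (V : vectType 'F_2) (v : E -> V).

Definition combination (x : {ffun E -> ('F_2)^o}) : V := \sum_e x e *: v e.

Fact combination_is_linear : linear combination.
Proof.
move=> a x y; rewrite /combination scaler_sumr -big_split /=.
by apply: eq_bigr => e _; rewrite !ffunE scalerDl scalerA.
Qed.

HB.instance Definition _ :=
  GRing.isLinear.Build _ _ _ _ combination combination_is_linear.

Lemma combination_indicator (A : {set E}) :
  combination (indicator A) = \sum_(e in A) v e.
Proof.
rewrite [RHS]big_mkcond; apply: eq_bigr => e _; rewrite ffunE.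
by case: (e \in A); rewrite ?scale1r ?scale0r.
Qed.

Variable M : matroid E.
Hypothesis repM : forall A : {set E}, indep M A = free [seq v e | e in A].

(* Over 'F_2 a nontrivial relation is a nonempty subset with zero sum; in a
   circuit, minimality forces this subset to be the whole circuit. *)
Lemma sum_circuit (C : {set E}) : circuit M C -> \sum_(e in C) v e = 0.
Proof.
move=> /minsetP[]; rewrite /dependent repM => /negP depC minC.
apply/eqP/negPn/negP => sumC; apply: depC; apply/free_imageP => k k0.
pose D := [set e in C | k e != 0].
have sDC : D \subset C by apply/subsetP => e; rewrite inE => /andP[].
have sumD : \sum_(e in D) v e = 0.
  rewrite -[RHS]k0 big_mkcond [RHS]big_mkcond; apply: eq_bigr => e _.
  rewrite inE {2}(F2_boolE (k e)); case: (e \in C) => //=.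
  by case: (k e == 0); rewrite ?scale1r ?scale0r.
(* If [D] is dependent, minimality gives [D = C], against [sumC]. Otherwise the relation on [D] with
   all coefficients 1 rules out any element of [D]. *)
have [indD | depD] := boolP (free [seq v e | e in D]); last first.
  by have /(_ D) := minC; rewrite repM depD => /(_ isT sDC) eDC;
     move: sumC; rewrite -eDC sumD eqxx.
move=> e eC; apply/eqP/negPn/negP => ke.
have eD : e \in D by rewrite inE eC.
move/free_imageP: indD => /(_ (fun=> 1)).
under eq_bigr do rewrite scale1r.
by move=> /(_ sumD e eD)/eqP; rewrite oner_eq0.
Qed.

Lemma circuit_space_sub_lker : (circuit_space M <= lker (linfun combination))%VS.
Proof.
apply/span_subvP => _ /imageP[C circC ->].
by rewrite memv_ker lfunE /= combination_indicator sum_circuit.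
Qed.

(** Each [v e] is the image of the indicator of a singleton, so the image contains the span of every
    independent set. *)
Lemma rank_le_limg : (rank M <= \dim (limg (linfun combination)))%N.
Proof.
apply/bigmax_leqP => A; rewrite repM => frA.
rewrite -(size_image v A) -(eqP frA); apply/dimvS/span_subvP.
move=> _ /imageP[e _ ->]; apply/memv_imgP; exists (indicator [set e]).
  exact: memvf.
by rewrite lfunE /= combination_indicator big_set1.
Qed.

Lemma dim_circuit_space : (\dim (circuit_space M) <= corank M)%N.
Proof.
apply: leq_trans (dimvS circuit_space_sub_lker) _.
rewrite /corank -(dim_ffun_regular 'F_2).
(* Rank-nullity; the truncated subtraction of [rank M] is harmless by [rank_le_limg]. *)
rewrite -(limg_ker_dim (linfun combination) fullv).
by rewrite capfv -addnBA ?rank_le_limg ?leq_addr.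
Qed.

End BinaryRepresentation.

Theorem proposition3p15 (E : finType) (M : matroid E) (g : nat)
    (C : 'I_g -> {set E}) (hC : circuit_system M C) :
  let w := [seq indicator (C i) | i : 'I_g] in
  [/\ {subset w <= circuit_space M},
      free w &
      binary M -> basis_of (circuit_space M) w].
Proof.
move=> w; case: hC => gE circC depC.
have subw : {subset w <= circuit_space M}.
  move=> _ /imageP[i _ ->]; apply/memv_span/imageP.
  by exists (C i) => //; apply: circC.
have frw : free w.
  (* A dependent unique union is nonempty, since the empty set is independent. *)
  apply: free_indicator => s /depC; apply: contraNneq => ->; exact: indep0.
split=> // -[n [v repM]]; rewrite basisEfree frw /=; apply/andP; split.
  exact/span_subvP.
by rewrite size_image card_ord gE (dim_circuit_space repM).
Qed.
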